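(* There exist $\mathbb{Z}$-spectral systems $(m,k,E,J)$ having $k=m+2$, which realize all odd values of $m\ge3$. Specifically, for any given integer $r\ge3$, let $m=2r-3$ and $k=2r-1$, and, with $\mathcal{V}=\{1,\dots,2m\}$, define $E:\mathcal{V}\to\mathbb{Z}$ by letting, for $j\in\{1,\dots,m\}$, $$(E(2j-1),E(2j))=\begin{cases}(r,\,-r+1)&\text{if }j=1,\\ (j-1,\,-2r+j)&\text{if }1<j<r-1\text{ and }r\text{ is even},\\ (2r+j-2,\,j-1)&\text{if }1<j<r-1\text{ and }r\text{ is odd},\\ (r-1,\,-r)&\text{if }j=r-1,\\ (j-2r+2,\,j-4r+3)&\text{if }r-1<j<m\text{ and }r\text{ is odd},\\ (j+1,\,j-2r+2)&\text{if }r-1<j<m\text{ and }r\text{ is even},\\ (r-2,\,-r-1)&\text{if }j=m,\end{cases}$$ and define $J:\mathcal{V}\to\{0,1\}$ by $J(i)=1$ if $E(i)$ is odd and $J(i)=0$ if $E(i)$ is even. Then $(m,k,E,J)$ is a $\mathbb{Z}$-spectral system. Here the set $Y=\{-1\}\cup\{E(i):i\in\mathcal{V},\ J(i)=1\}$ equals $\{-1\}\cup[\mathbb{Z}_{\mathrm{odd}}\cap E(\mathcal{V})]$, where $\mathbb{Z}_{\mathrm{odd}}=\mathbb{Z}\smallsetminus2\mathbb{Z}$. Also, $$Y=\mathbb{Z}_{\mathrm{odd}}\cap[-2r+3,\,2r-3]\quad\text{if }r\text{ is even},$$ $$Y=\mathbb{Z}_{\mathrm{odd}}\cap\big([-3r+4,\,-2r-1]\cup[-r,\,r]\cup[2r+1,\,3r-4]\big)\quad\text{if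 }r\text{ is odd}.$$
   Context: A $\mathbb{Z}$-spectral system is a quadruple $(m,k,E,J)$ consisting of integers $m,k\ge2$, an injective function $E:\mathcal{V}\to\mathbb{Z}\smallsetminus\{-1\}$, where $\mathcal{V}=\{1,\dots,2m\}$, and a function $J:\mathcal{V}\to\{0,1\}$, satisfying the following conditions for all $i,i'\in\mathcal{V}$: (a) $k+1=2E(1)$; (b) $E(i)+E(i')=-1$ and $J(i)\ne J(i')$ whenever $i+i'=2m+1$; (c) $E(i)-E(i')=k$ and $J(i)\ne J(i')$ whenever $i'=i+1$ is even; (d) the set $Y=\{-1\}\cup\{E(i):i\in\mathcal{V}\text{ and }J(i)=1\}$ is symmetric about $0$. Intervals are $[a,b]=\{x\in\mathbb{R}:a\le x\le b\}$, understood to be empty if $a>b$ (which happens above only for $r=3$). *)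

(* Defs.v *)
From mathcomp Require Import all_boot all_order all_algebra.
From mathcomp Require Import classical_sets.
Set Implicit Arguments.
Unset Strict Implicit.
Unset Printing Implicit Defensive.
Import Order.TTheory GRing.Theory Num.Theory.
Local Open Scope ring_scope.
Local Open Scope classical_set_scope.

(* The index set {1, ..., 2m}, numbered from 1 (unlike 'I_(2 * m)). *)
Definition vtx (m : nat) : Type := {i : nat | (1 <= i <= 2 * m)%N}.

(* The values 0, 1 of J are encoded as false, true. *)
Definition Yset (m : nat) (E : vtx m -> int) (J : vtx m -> bool) : set int :=
  [set -1] `|` [set E i | i in [set i | J i = true]].

Definition symmetric0 (A : set int) : Prop := forall y, A y -> A (- y).

Record Zspectral (m : nat) (k : int) (E : vtx m -> int) (J : vtx m -> bool)
    : Prop := {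
  Zs_m_ge2 : (2 <= m)%N;
  Zs_k_ge2 : 2 <= k;
  Zs_inj : injective E;
  Zs_neqN1 : forall i, E i <> -1;
  Zs_a : forall i, \val i = 1%N -> k + 1 = 2 * E i;
  Zs_b : forall i i', (\val i + \val i' = 2 * m + 1)%N ->
           E i + E i' = -1 /\ J i <> J i';
  Zs_c : forall i i', \val i' = (\val i + 1)%N -> ~~ odd (\val i') ->
           E i - E i' = k /\ J i <> J i';
  Zs_d : symmetric0 (Yset E J)
}.

Definition Zodd : set int := [set z | ~~ (2 %| z)%Z].

Definition m_of (r : nat) : nat := (2 * r - 3)%N.
Definition k_of (r : nat) : int := 2 * r%:Z - 1.

(* The pair (E(2j-1), E(2j)), meant for 3 <= r and 1 <= j <= m_of r, where the
   final branch is the case j = m_of r. *)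
Definition Epair (r j : nat) : int * int :=
  let R := r%:Z in let K := j%:Z in
  if j == 1%N then (R, - R + 1)
  else if (1 < j < r - 1)%N then
    if odd r then (2 * R + K - 2, K - 1) else (K - 1, - 2 * R + K)
  else if j == (r - 1)%N then (R - 1, - R)
  else if (r - 1 < j < m_of r)%N then
    if odd r then (K - 2 * R + 2, K - 4 * R + 3) else (K + 1, K - 2 * R + 2)
  else (R - 2, - R - 1).

(* uphalf i is j for both i = 2j-1 and i = 2j. *)
Definition E_of (r : nat) (i : vtx (m_of r)) : int :=
  if odd (\val i) then (Epair r (uphalf (\val i))).1
  else (Epair r (uphalf (\val i))).2.

Definition J_of (r : nat) (i : vtx (m_of r)) : bool := ~~ (2 %| E_of i)%Z.

(* Main.v *)
Require Import Defs.
From mathcomp Require Import all_boot all_order all_algebra.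
From mathcomp Require Import classical_sets.
From mathcomp Require Import zify.
Set Implicit Arguments.
Unset Strict Implicit.
Unset Printing Implicit Defensive.
Import Order.TTheory GRing.Theory Num.Theory.
Local Open Scope ring_scope.
Local Open Scope classical_set_scope.

(** The idea is to look only at the odd-numbered vertices.  Write
    F j = E(2j-1) for 1 <= j <= m, where m = 2r-3 and k = 2r-1.  In each branch
    of the definition E(2j) = F j - k, which is condition (c), so E is
    determined by F, and condition (b) becomes the reflection identity
    F j + F (m+1-j) = m+1.

    The values of F form a complete list of the residues 1, ..., m modulo k:
    for even r they are the integers 1, ..., m themselves, and for odd r the
    residues 1, ..., r-3 are represented in [2r, 3r-4], the residues
    r+1, ..., 2r-3 in [-r+2, -2], and r-2, r-1, r by themselves.  Since m values
    cover m residues, F j and F j' are incongruent modulo k whenever j and j'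
    differ, which makes E injective.  The residues 0 and -1 are avoided, so
    that E never takes the value -1.

    The range of E is the union of the range of F and its translate by -k.
    Its odd elements together with -1 are the sets Y of the last two claims,
    and these are visibly symmetric about 0.  In (b) and (c) the values of J
    differ because -1 and k are odd and J records the parity of E. *)

(** * The values at odd-numbered vertices *)

(* Each branch of the definition of E is linear in r and j. *)
Ltac Epair_lia := rewrite /Epair /k_of /m_of; repeat case: ifP => ? /=; lia.

Section SpectralFamily.
Variable r : nat.
Hypothesis r_ge3 : (3 <= r)%N.

Local Notation F j := (Epair r j).1.

Lemma Epair_snd j : (Epair r j).2 = F j - k_of r.
Proof. by Epair_lia. Qed.

(** The branches of the definition are exchanged in pairs by j |-> m+1-j, the
    branch j = r-1 being its fixed point. *)
Lemma Epair_fst_reflect j j' :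
    (1 <= j)%N -> (1 <= j')%N -> (j + j' = 2 * r - 2)%N ->
  F j + F j' = 2 * r%:Z - 2.
Proof.
move=> j_gt0 j'_gt0 sum_jj'.
by Epair_lia.
Qed.

(** The values of F are pairwise incongruent modulo k.  Only the differences 0,
    k and -k matter for the injectivity of E, whose values are those of F with
    either 0 or k subtracted. *)
Lemma Epair_fst_separated j j' :
    (1 <= j <= m_of r)%N -> (1 <= j' <= m_of r)%N ->
    [|| F j == F j', F j == F j' - k_of r | F j' == F j - k_of r] ->
  j = j'.
Proof.
by Epair_lia.
Qed.

(** For even r, F permutes {1, ..., m}. *)
Lemma Epair_fst_range_even x : ~~ odd r ->
  (exists2 j, (1 <= j <= m_of r)%N & F j = x) <-> 1 <= x <= 2 * r%:Z - 3.
Proof.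
move=> r_even; split=> [[j j_bnd <-]|x_bnd].
  by move: j_bnd; Epair_lia.
(* The permutation shifts j by one on either side of r-1 and sends 1 to r and
   m to r-2. *)
have [x_r|x_neq_r] := eqVneq x r%:Z; first by exists 1%N; Epair_lia.
have [x_r1|x_neq_r1] := eqVneq x (r%:Z - 1).
  by exists (r - 1)%N; Epair_lia.
have [x_r2|x_neq_r2] := eqVneq x (r%:Z - 2); first by exists (m_of r); Epair_lia.
have [x_lt|x_ge] := ltP x r%:Z; first by exists (absz x).+1; Epair_lia.
by exists (absz x).-1; Epair_lia.
Qed.

Lemma Epair_fst_range_odd x : odd r ->
  (exists2 j, (1 <= j <= m_of r)%N & F j = x) <->
  [|| 2 * r%:Z <= x <= 3 * r%:Z - 4, r%:Z - 2 <= x <= r%:Z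
    | - r%:Z + 2 <= x <= -2].
Proof.
move=> r_odd; split=> [[j j_bnd <-]|x_bnd].
  by move: j_bnd; Epair_lia.
have [x_r|x_neq_r] := eqVneq x r%:Z; first by exists 1%N; Epair_lia.
have [x_r1|x_neq_r1] := eqVneq x (r%:Z - 1).
  by exists (r - 1)%N; Epair_lia.
have [x_r2|x_neq_r2] := eqVneq x (r%:Z - 2); first by exists (m_of r); Epair_lia.
have [x_lt|x_ge] := ltP x 0.
  by exists (absz (x + 2 * r%:Z - 2)%R); Epair_lia.
by exists (absz (x - 2 * r%:Z + 2)%R); Epair_lia.
Qed.

(** * From the first values to E *)

Lemma vtx_uphalf_bounds (i : vtx (m_of r)) : (1 <= uphalf (\val i) <= m_of r)%N.
Proof. by case: i => n /= n_bnd; lia. Qed.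

Lemma vtx_of_nat n : (1 <= n <= 2 * m_of r)%N ->
  exists i : vtx (m_of r), \val i = n.
Proof. by move=> n_bnd; exists (exist _ n n_bnd). Qed.

Lemma E_of_fst (i : vtx (m_of r)) :
  E_of i = F (uphalf (\val i)) - (if odd (\val i) then 0 else k_of r).
Proof. by rewrite /E_of Epair_snd; case: ifP => _ //; rewrite subr0. Qed.

Lemma E_of_inj : injective (@E_of r).
Proof.
move=> i i'; rewrite !E_of_fst => eqE; apply: val_inj.
have eq_j : uphalf (\val i) = uphalf (\val i').
  apply: Epair_fst_separated; try exact: vtx_uphalf_bounds.
  by move: eqE; case: ifP => _; case: ifP => _; lia.
(* The two vertices of one pair have E-values k apart. *)
move: eqE; rewrite eq_j /k_of; case: ifP => ?; case: ifP => ?; lia.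
Qed.

Lemma range_E_of y :
  range (@E_of r) y <->
  (exists2 j, (1 <= j <= m_of r)%N & F j = y) \/
  (exists2 j, (1 <= j <= m_of r)%N & F j = y + k_of r).
Proof.
split=> [[i _ <-]|].
  rewrite E_of_fst; have j_bnd := vtx_uphalf_bounds i; case: ifP => _.
    by left; exists (uphalf (\val i)); rewrite ?subr0.
  by right; exists (uphalf (\val i)); rewrite ?subrK.
case=> -[j j_bnd Fj].
  have [|i val_i] := @vtx_of_nat (2 * j).-1; first by lia.
  exists i => //; rewrite E_of_fst val_i.
  have -> : uphalf (2 * j).-1 = j by lia.
  by rewrite ifT ?subr0 //; lia.
have [|i val_i] := @vtx_of_nat (2 * j)%N; first by lia.
exists i => //; rewrite E_of_fst val_i.
have -> : uphalf (2 * j) = j by lia.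
by rewrite ifF ?Fj ?addrK //; lia.
Qed.

(** The gap at -1 and 0 is the pair of residues modulo k that F avoids. *)
Lemma range_E_of_even : ~~ odd r ->
  range (@E_of r) =
    [set y | [&& - 2 * r%:Z + 2 <= y <= 2 * r%:Z - 3, y != -1 & y != 0]].
Proof.
move=> r_even; apply/seteqP; split=> y /=.
  by move/range_E_of; rewrite !Epair_fst_range_even // /k_of; lia.
by move=> y_bnd; apply/range_E_of; rewrite !Epair_fst_range_even // /k_of; lia.
Qed.

Lemma range_E_of_odd : odd r ->
  range (@E_of r) =
    [set y | [&& [|| - 3 * r%:Z + 3 <= y <= - 2 * r%:Z - 1,
                     - r%:Z - 1 <= y <= r%:Z
                   | 2 * r%:Z <= y <= 3 * r%:Z - 4], y != -1 & y != 0]].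
Proof.
move=> r_odd; apply/seteqP; split=> y /=.
  by move/range_E_of; rewrite !Epair_fst_range_odd // /k_of; lia.
by move=> y_bnd; apply/range_E_of; rewrite !Epair_fst_range_odd // /k_of; lia.
Qed.

Lemma E_of_neqN1 (i : vtx (m_of r)) : E_of i <> -1.
Proof.
move=> Ei; have : range (@E_of r) (-1) by exists i.
case: (boolP (odd r)) => r_parity.
  by rewrite range_E_of_odd //= andbF.
by rewrite range_E_of_even //= andbF.
Qed.

(** * The set Y *)

Lemma Yset_E_of : Yset (@E_of r) (@J_of r) = [set -1] `|` (Zodd `&` range (@E_of r)).
Proof.
rewrite /Yset; congr (_ `|` _); apply/seteqP; split=> y /=.
  by case=> i Ji <-; split=> //; exists i.
by case=> y_odd [i _ Ei]; exists i => //=; rewrite /J_of Ei.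
Qed.

Lemma Yset_E_of_even : ~~ odd r ->
  Yset (@E_of r) (@J_of r) = Zodd `&` `[- 2 * r%:Z + 3, 2 * r%:Z - 3].
Proof.
move=> r_even; rewrite Yset_E_of range_E_of_even //.
by apply/seteqP; split=> y; rewrite /setU /setI /Zodd /= in_itv /=; lia.
Qed.

Lemma Yset_E_of_odd : odd r ->
  Yset (@E_of r) (@J_of r) =
    Zodd `&` (`[- 3 * r%:Z + 4, - 2 * r%:Z - 1]
              `|` `[- r%:Z, r%:Z]
              `|` `[2 * r%:Z + 1, 3 * r%:Z - 4]).
Proof.
move=> r_odd; rewrite Yset_E_of range_E_of_odd //.
by apply/seteqP; split=> y; rewrite /setU /setI /Zodd /= !in_itv /=; lia.
Qed.

Lemma Yset_E_of_symmetric : symmetric0 (Yset (@E_of r) (@J_of r)).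
Proof.
move=> y; case: (boolP (odd r)) => ?.
  by rewrite Yset_E_of_odd // /setU /setI /Zodd /= !in_itv /=; lia.
by rewrite Yset_E_of_even // /setU /setI /Zodd /= !in_itv /=; lia.
Qed.

(** * The spectral system *)

Lemma k_of_m_of : k_of r = (m_of r)%:Z + 2.
Proof. by rewrite /k_of /m_of; lia. Qed.

Lemma E_of_sum (i i' : vtx (m_of r)) : (\val i + \val i' = 2 * m_of r + 1)%N ->
  E_of i + E_of i' = -1.
Proof.
move=> sum_ii'; rewrite !E_of_fst.
have := vtx_uphalf_bounds i; have := vtx_uphalf_bounds i'.
move: (\val i) (\val i') sum_ii' => n n' sum_nn' n'_bnd n_bnd.
have := @Epair_fst_reflect (uphalf n) (uphalf n').
move: (F _) (F _) => x x'; rewrite /k_of /m_of in sum_nn' n_bnd n'_bnd *.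
by case: ifP => ?; case: ifP => ? sum_xx'; lia.
Qed.

Lemma E_of_diff (i i' : vtx (m_of r)) :
  \val i' = (\val i + 1)%N -> ~~ odd (\val i') -> E_of i - E_of i' = k_of r.
Proof.
move=> succ_i even_i'; rewrite !E_of_fst (negbTE even_i').
have odd_i : odd (\val i) by lia.
have -> : uphalf (\val i') = uphalf (\val i) by lia.
by rewrite odd_i; lia.
Qed.

Lemma Zspectral_E_of : Zspectral (k_of r) (@E_of r) (@J_of r).
Proof.
split.
- by rewrite /m_of; lia.
- by rewrite /k_of; lia.
- exact: E_of_inj.
- exact: E_of_neqN1.
- by move=> i i1; rewrite E_of_fst i1 /Epair /k_of /=; lia.
- move=> i i' /E_of_sum sumE; split=> //.
  by rewrite /J_of => eqJ; lia.
- move=> i i' succ_i even_i'; have diffE := E_of_diff succ_i even_i'.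
  by split=> //; move: diffE; rewrite /J_of /k_of => diffE eqJ; lia.
- exact: Yset_E_of_symmetric.
Qed.

End SpectralFamily.

Theorem theorem2p2 :
  (forall m : nat, odd m -> (3 <= m)%N ->
     exists (E : vtx m -> int) (J : vtx m -> bool), Zspectral (m%:Z + 2) E J)
  /\
  (forall r : nat, (3 <= r)%N ->
     [/\ k_of r = (m_of r)%:Z + 2,
         Zspectral (k_of r) (@E_of r) (@J_of r),
         Yset (@E_of r) (@J_of r) = [set -1] `|` (Zodd `&` range (@E_of r)),
         ~~ odd r ->
           Yset (@E_of r) (@J_of r) = Zodd `&` `[- 2 * r%:Z + 3, 2 * r%:Z - 3]
       & odd r ->
           Yset (@E_of r) (@J_of r) =
             Zodd `&` (`[- 3 * r%:Z + 4, - 2 * r%:Z - 1]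
                       `|` `[- r%:Z, r%:Z]
                       `|` `[2 * r%:Z + 1, 3 * r%:Z - 4])]).
Proof.
split=> [m m_odd m_ge3|r r_ge3].
  have r_ge3 : (3 <= (m + 3)./2)%N by lia.
  have -> : m = m_of (m + 3)./2 by rewrite /m_of; lia.
  exists (@E_of _), (@J_of _); rewrite -k_of_m_of //; exact: Zspectral_E_of.
split.
- exact: k_of_m_of.
- exact: Zspectral_E_of.
- exact: Yset_E_of.
- exact: Yset_E_of_even.
- exact: Yset_E_of_odd.
Qed.
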